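(* Let $f:\mathbb{R}^d\to\mathbb{R}$ be twice differentiable, $m$-strongly convex and $L$-smooth ($0<m\le L$), with unique minimizer $x_\star$. Let $(\mathcal{G}_k)_{k\ge 0}$ be a filtration and, for each $k\ge 0$, let $\varepsilon_{k+1}(\cdot)$ be a $\mathcal{G}_{k+1}$-measurable random field on $\mathbb{R}^d$ with values in $\mathbb{R}^d$ such that $\mathbb{E}[\varepsilon_{k+1}(\zeta)\mid\mathcal{G}_k]=0$ for every $\zeta$, the fields $\{\varepsilon_k\}_{k>0}$ being independent and identically distributed. Let $a_k>0$ and $A_k=\sum_{i=1}^k a_i$. For $k\ge1$ set $\phi_k(x)=\sum_{i=1}^k\frac{a_i m}{2}\|x-x_i\|^2$, so that its convex conjugate satisfies $\nabla\phi_k^\star(z)=\dfrac{z+m\sum_{i=1}^k a_ix_i}{A_km}$. Let $(x_k,y_k,z_k)_{k\ge1}$ be iterates of the implicit accelerated dual averaging method, i.e. (with $x_k$ $\mathcal{G}_k$-measurable) for all $k\ge1$, $$x_k=\frac{A_{k-1}}{A_k}y_{k-1}+\frac{a_k}{A_k}\nabla\phi_k^\star(z_{k-1}),\quad \omega_k=\nabla f(x_k)+\varepsilon_{k+1}(x_k),\quad z_k=z_{k-1}-a_k\omega_k,\quad y_k=\frac{A_{k-1}}{A_k}y_{k-1}+\frac{a_k}{A_k}\nabla\phi_k^\star(z_k).$$ Define $U_k=f(y_k)$, $$L_k=\frac{1}{A_k}\Big[\sum_{i=1}^k a_i\big(f(x_i)-\varepsilon_{i+1}(x_i)^\top(x_\star-x_i)\big)+\min_x\sum_{i=1}^k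 a_i\Big(\omega_i^\top(x-x_i)+\frac m2\|x-x_i\|^2\Big)\Big],$$ and $G_k=U_k-L_k$. Writing $\gamma_k=a_k/A_k$, for every $k\ge2$, $$\mathbb{E}[G_k]\le(1-\gamma_k)\mathbb{E}[G_{k-1}]-m_k\,\mathbb{E}\|\nabla f(x_k)\|^2+n_k\,\mathbb{E}\|\varepsilon_{k+1}(x_k)\|^2,$$ where $m_k=\Big(\frac m2-\frac{\gamma_k^2L}{2}\Big)\frac{\gamma_k^2}{m^2}$ and $n_k=\frac{\gamma_k^2}{m}-\Big(\frac m2-\frac{\gamma_k^2L}{2}\Big)\frac{\gamma_k^2}{m^2}$.
   Context: $\|\cdot\|$ is the Euclidean norm. A function is $m$-strongly convex and $L$-smooth if $f(x)+\nabla f(x)^\top(y-x)+\frac m2\|y-x\|^2\le f(y)\le f(x)+\nabla f(x)^\top(y-x)+\frac L2\|y-x\|^2$ for all $x,y$. The convex conjugate is $\psi^\star(z)=\max_x\{z^\top x-\psi(x)\}$. The paper phrases this result as: with $m_0=0$ the method has the ''property of robustness'' $\mathbb{E}[\mathcal{E}_{k+1}]\le(1-r_k)\mathbb{E}[\mathcal{E}_k]-m_k\mathbb{E}\|\nabla f(\zeta_k)\|^2+n_k\mathbb{E}\|\varepsilon_{k+1}(\zeta_k)\|^2$ with $\mathcal{E}_k=G_k$, $r_k=a_k/A_k$.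
   Formalization: The condition E[ε_{k+1}(ζ)|G_k]=0 is assumed for every G_k-measurable random ζ with ε_{k+1}(ζ) integrable (with only deterministic ζ the claim can fail), and E‖x_k‖² and E‖ε_{k+1}(x_k)‖² are assumed finite for all k≥1. *)

(* Defs.v *)
From HB Require Import structures.
From mathcomp Require Import all_boot all_order all_algebra.
From mathcomp Require Import all_classical all_reals all_analysis.
Set Implicit Arguments. Unset Strict Implicit. Unset Printing Implicit Defensive.
Import Order.TTheory GRing.Theory Num.Theory.
Import numFieldNormedType.Exports.
Local Open Scope classical_set_scope.
Local Open Scope ring_scope.

Section Euclid.
Context {R : realType} {d : nat}.

Definition dotv (u v : 'rV[R]_d) : R := \sum_(i < d) u ord0 i * v ord0 i.

Definition enorm (u : 'rV[R]_d) : R := Num.sqrt (dotv u u).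

Definition grad (f : 'rV[R]_d -> R) (x : 'rV[R]_d) : 'rV[R]_d :=
  \row_(i < d) derive f x (delta_mx ord0 i).

Definition twice_differentiable (f : 'rV[R]_d -> R) : Prop :=
  (forall x, differentiable f x) /\ (forall x, differentiable (grad f) x).

Definition strongly_convex_smooth (m L : R) (f : 'rV[R]_d -> R) : Prop :=
  forall x y,
    f x + dotv (grad f x) (y - x) + m / 2 * enorm (y - x) ^+ 2 <= f y /\
    f y <= f x + dotv (grad f x) (y - x) + L / 2 * enorm (y - x) ^+ 2.

End Euclid.

Section Prob.
Context {dT : measure_display} {T : measurableType dT} {R : realType} {d : nat}.

Definition sub_sigma (G : set (set T)) : Prop :=
  sigma_algebra setT G /\ G `<=` measurable.

Definition filtration (G : nat -> set (set T)) : Prop :=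
  (forall k, sub_sigma (G k)) /\ (forall k, G k `<=` G k.+1).

Definition measR (G : set (set T)) (X : T -> R) : Prop :=
  forall B : set R, measurable B -> G (X @^-1` B).

Definition measV (G : set (set T)) (X : T -> 'rV[R]_d) : Prop :=
  forall i : 'I_d, measR G (fun w => X w ord0 i).

Definition prod_gen (G : set (set T)) : set (set (T * 'rV[R]_d)) :=
  [set S | exists A, G A /\ S = A `*` [set: 'rV[R]_d]] `|`
  [set S | exists (i : 'I_d) (B : set R), measurable B /\
            S = [set p : T * 'rV[R]_d | B (p.2 ord0 i)]].

(** a random field eps : T -> R^d -> R^d is G-measurable, i.e. jointly
    measurable w.r.t. G (x) Borel(R^d) *)
Definition field_meas (G : set (set T))
    (eps : T -> 'rV[R]_d -> 'rV[R]_d) : Prop :=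
  forall (i : 'I_d) (B : set R), measurable B ->
    smallest (sigma_algebra setT) (prod_gen G) [set p | B (eps p.1 p.2 ord0 i)].

Variable P : probability T R.

Definition cond_mean_zero (G : set (set T)) (X : T -> 'rV[R]_d) : Prop :=
  (forall i : 'I_d, P.-integrable setT (fun w => (X w ord0 i)%:E)) /\
  (forall (A : set T) (i : 'I_d), G A ->
     (\int[P]_(w in A) (X w ord0 i)%:E = 0)%E).

Definition field_sigma (eps : T -> 'rV[R]_d -> 'rV[R]_d) : set (set T) :=
  smallest (sigma_algebra setT)
    [set A | exists (zeta : 'rV[R]_d) (i : 'I_d) (B : set R),
        measurable B /\ A = [set w | B (eps w zeta ord0 i)]].

Definition fields_independent (eps : nat -> T -> 'rV[R]_d -> 'rV[R]_d) : Prop :=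
  forall (s : seq nat) (A : nat -> set T), uniq s ->
    (forall k, k \in s -> (0 < k)%N /\ field_sigma (eps k) (A k)) ->
    P (\bigcap_(k in [set` s]) A k) = (\prod_(k <- s) P (A k))%E.

(** the fields (eps k)_{k > 0} are identically distributed (same finite
    dimensional distributions as eps 1) *)
Definition fields_identically_distributed
    (eps : nat -> T -> 'rV[R]_d -> 'rV[R]_d) : Prop :=
  forall (k n : nat) (zeta : 'I_n -> 'rV[R]_d) (B : 'I_n -> 'I_d -> set R),
    (0 < k)%N -> (forall j i, measurable (B j i)) ->
    P [set w | forall j i, B j i (eps k w (zeta j) ord0 i)] =
    P [set w | forall j i, B j i (eps 1%N w (zeta j) ord0 i)].

Definition Ex (X : T -> R) : R := \int[P]_(w in setT) X w.

End Prob.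

Section IADA.
Context {R : realType} {d : nat} {T : Type}.

Definition Acoef (a : nat -> R) (k : nat) : R := \sum_(1 <= i < k.+1) a i.

Definition grad_phistar (a : nat -> R) (m : R) (x : nat -> T -> 'rV[R]_d)
    (k : nat) (w : T) (z : 'rV[R]_d) : 'rV[R]_d :=
  (Acoef a k * m)^-1 *: (z + m *: \sum_(1 <= i < k.+1) a i *: x i w).

Definition omega (f : 'rV[R]_d -> R) (eps : nat -> T -> 'rV[R]_d -> 'rV[R]_d)
    (x : nat -> T -> 'rV[R]_d) (k : nat) (w : T) : 'rV[R]_d :=
  grad f (x k w) + eps k.+1 w (x k w).

Definition iada_iterates (f : 'rV[R]_d -> R) (m : R) (a : nat -> R)
    (eps : nat -> T -> 'rV[R]_d -> 'rV[R]_d)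
    (x y z : nat -> T -> 'rV[R]_d) : Prop :=
  forall k w, (1 <= k)%N ->
    [/\ x k w = (Acoef a k.-1 / Acoef a k) *: y k.-1 w
                + (a k / Acoef a k) *: grad_phistar a m x k w (z k.-1 w),
        z k w = z k.-1 w - a k *: omega f eps x k w
      & y k w = (Acoef a k.-1 / Acoef a k) *: y k.-1 w
                + (a k / Acoef a k) *: grad_phistar a m x k w (z k w)].

Definition Lbound (f : 'rV[R]_d -> R) (m : R) (a : nat -> R)
    (eps : nat -> T -> 'rV[R]_d -> 'rV[R]_d) (x : nat -> T -> 'rV[R]_d)
    (xstar : 'rV[R]_d) (k : nat) (w : T) : R :=
  (Acoef a k)^-1 *
  (\sum_(1 <= i < k.+1)
      a i * (f (x i w) - dotv (eps i.+1 w (x i w)) (xstar - x i w))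
   + inf (range (fun v : 'rV[R]_d =>
        \sum_(1 <= i < k.+1)
          a i * (dotv (omega f eps x i w) (v - x i w)
                 + m / 2 * enorm (v - x i w) ^+ 2)))).

Definition gap (f : 'rV[R]_d -> R) (m : R) (a : nat -> R)
    (eps : nat -> T -> 'rV[R]_d -> 'rV[R]_d) (x y : nat -> T -> 'rV[R]_d)
    (xstar : 'rV[R]_d) (k : nat) (w : T) : R :=
  f (y k w) - Lbound f m a eps x xstar k w.

End IADA.

(* Main.v *)
(** Since [A_0 = 0], the first step forces [z_0 = 0], so [z_k] is minus the
    weighted sum of the [omega_i] and [grad phi_k^*(z_k)] is the minimizer of the
    strongly convex quadratic [psi_k] inside [L_k].  Comparing [psi_k] with
    [psi_(k-1)] around their minimizers, and using convexity at [y_(k-1)] and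
    smoothness along [y_k - x_k = - (gamma_k^2 / m) omega_k], gives the inequality
    pathwise up to an extra term [eps_(k+1)(x_k) . V] with [V] measurable for
    [G_k].  Everything in sight is integrable because [|grad f x|^2] and
    [f x - f xstar] are at most quadratic in [x - xstar], and the extra term has
    mean zero: [E (X W) = 0] for [G]-measurable [W] whenever [X] has zero integral
    on the sets of [G], by approximating [W] with [G]-simple functions. *)
Require Import Defs.
From HB Require Import structures.
From mathcomp Require Import all_boot all_order all_algebra.
From mathcomp Require Import all_classical all_reals all_analysis.
From mathcomp Require Import measurable_realfun ring lra.
Import Order.TTheory GRing.Theory Num.Theory.
Import numFieldNormedType.Exports.
Local Open Scope classical_set_scope.
Local Open Scope ring_scope.

(** * Inner product and norm on row vectors *)

Section Euclidean.
Context {R : realType} {d : nat}.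
Implicit Types (u v w c : 'rV[R]_d) (r : R).

Lemma dotvC u v : dotv u v = dotv v u.
Proof. by apply: eq_bigr => i _; rewrite mulrC. Qed.

Lemma dotvDl u v w : dotv (u + v) w = dotv u w + dotv v w.
Proof. by rewrite -big_split; apply: eq_bigr => i _; rewrite mxE mulrDl. Qed.

Lemma dotvZl r u v : dotv (r *: u) v = r * dotv u v.
Proof. by rewrite /dotv mulr_sumr; apply: eq_bigr => i _; rewrite mxE mulrA. Qed.

Lemma dotvDr u v w : dotv u (v + w) = dotv u v + dotv u w.
Proof. by rewrite dotvC dotvDl !(dotvC u). Qed.

Lemma dotvZr r u v : dotv u (r *: v) = r * dotv u v.
Proof. by rewrite dotvC dotvZl dotvC. Qed.

Lemma dotvNl u v : dotv (- u) v = - dotv u v.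
Proof. by rewrite -scaleN1r dotvZl mulN1r. Qed.

Lemma dotvNr u v : dotv u (- v) = - dotv u v.
Proof. by rewrite dotvC dotvNl dotvC. Qed.

Lemma dotv0l v : dotv 0 v = 0.
Proof. by rewrite -(scale0r 0) dotvZl mul0r. Qed.

Definition dotvE := (dotvDl, dotvDr, dotvNl, dotvNr, dotvZl, dotvZr).

Lemma dotv_suml (I : Type) (s : seq I) (F : I -> 'rV[R]_d) v :
  dotv (\sum_(i <- s) F i) v = \sum_(i <- s) dotv (F i) v.
Proof.
by elim/big_rec2: _ => [|i x y _ <-]; rewrite ?dotv0l ?dotvDl.
Qed.

Lemma dotvv_ge0 u : 0 <= dotv u u.
Proof. by apply: sumr_ge0 => i _; rewrite -expr2 sqr_ge0. Qed.

Lemma enorm_sq u : enorm u ^+ 2 = dotv u u.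
Proof. by rewrite sqr_sqrtr ?dotvv_ge0. Qed.

Lemma sqr_coord_le_dotvv u (i : 'I_d) : u ord0 i ^+ 2 <= dotv u u.
Proof.
rewrite /dotv (bigD1 i) //= expr2 lerDl.
by apply: sumr_ge0 => j _; rewrite -expr2 sqr_ge0.
Qed.

(** * Weighted quadratics, their minimizers, and the one-step inequality *)

Section Quadratic.
Variables (m : R) (a : nat -> R) (x om : nat -> 'rV[R]_d) (k : nat).

Definition quad v : R := \sum_(1 <= i < k.+1)
  a i * (dotv (om i) (v - x i) + m / 2 * enorm (v - x i) ^+ 2).

(** The hypothesis on [c] says that the gradient of [quad] vanishes at [c]. The expansion of [quad]
    about [c] is exact at second order and then has no linear term. *)
Lemma quad_center c v :
  (Acoef a k * m) *: c
    = - (\sum_(1 <= i < k.+1) a i *: om i) + m *: \sum_(1 <= i < k.+1) a i *: x i ->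
  quad v = quad c + Acoef a k * (m / 2) * dotv (v - c) (v - c).
Proof.
move=> hc; apply/eqP; rewrite addrC -subr_eq -sumrB; apply/eqP.
(* Each summand is expanded about [c]. The vector paired with [v - c] is its gradient at [c], and
   these gradients sum to zero by [hc]. *)
have -> : \sum_(1 <= i < k.+1) (a i * (dotv (om i) (v - x i)
      + m / 2 * enorm (v - x i) ^+ 2)
    - a i * (dotv (om i) (c - x i) + m / 2 * enorm (c - x i) ^+ 2))
  = \sum_(1 <= i < k.+1) (dotv (a i *: om i + (a i * m) *: (c - x i)) (v - c)
      + a i * (m / 2 * dotv (v - c) (v - c))).
  apply: eq_bigr => i _; rewrite !enorm_sq !dotvE.
  by rewrite (dotvC c v) (dotvC (x i) v) (dotvC (x i) c); field.
rewrite big_split/= -dotv_suml -mulr_suml -/(Acoef a k) big_split/=.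
have -> : \sum_(1 <= i < k.+1) (a i * m) *: (c - x i)
    = (Acoef a k * m) *: c - m *: \sum_(1 <= i < k.+1) a i *: x i.
  rewrite /Acoef mulr_suml scaler_suml scaler_sumr -sumrB.
  by apply: eq_bigr => i _; rewrite scalerBr scalerA (mulrC m).
by rewrite hc addrK subrr dotv0l add0r mulrA.
Qed.

Lemma inf_quad c : 0 <= Acoef a k * m ->
  (Acoef a k * m) *: c
    = - (\sum_(1 <= i < k.+1) a i *: om i) + m *: \sum_(1 <= i < k.+1) a i *: x i ->
  inf (range quad) = quad c.
Proof.
move=> Am0 hc.
have lb : lbound (range quad) (quad c).
  move=> _ [v _ <-]; rewrite (quad_center _ v hc) lerDl mulr_ge0 ?dotvv_ge0//.
  by rewrite mulrA divr_ge0.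
apply/eqP; rewrite eq_le ge_inf ?lb_le_inf//.
- by exists (quad c), c.
- by exists (quad c).
Qed.

End Quadratic.

Lemma quadS (m : R) (a : nat -> R) (x om : nat -> 'rV[R]_d) k v :
  quad m a x om k.+1 v = quad m a x om k v
    + a k.+1 * (dotv (om k.+1) (v - x k.+1) + m / 2 * enorm (v - x k.+1) ^+ 2).
Proof. by rewrite /quad big_nat_recr. Qed.

(** The algebraic core of one step, with no probability. A suffix [1] marks the previous step: [c1]
    and [c] stand for the minimizers of the quadratics, [Q1] for the old minimum, [S1] for the old
    sum of function values, [u] for the new mirror map at the old dual point, [g] for the gradient,
    [e] for the noise and [s] for [xstar]. *)
Lemma gap_step_vectors (A al m L fx fy fy1 S1 Q1 : R) (x y y1 c c1 u g e s : 'rV[R]_d) :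
  let gam := al / (A + al) in
  let mk := (m / 2 - gam ^+ 2 * L / 2) * gam ^+ 2 / m ^+ 2 in
  let nk := gam ^+ 2 / m - (m / 2 - gam ^+ 2 * L / 2) * gam ^+ 2 / m ^+ 2 in
  0 < m -> 0 < A -> 0 < al ->
  u = (A / (A + al)) *: c1 + gam *: x ->
  x = (A / (A + al)) *: y1 + gam *: u ->
  c = u - (gam / m) *: (g + e) ->
  y = x - (gam ^+ 2 / m) *: (g + e) ->
  fy <= fx + dotv g (y - x) + L / 2 * enorm (y - x) ^+ 2 ->
  fx + dotv g (y1 - x) <= fy1 ->
  fy - (A + al)^-1 * (S1 + al * (fx - dotv e (s - x))
    + (Q1 + A * (m / 2) * dotv (c - c1) (c - c1)
       + al * (dotv (g + e) (c - x) + m / 2 * enorm (c - x) ^+ 2)))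
  <= (1 - gam) * (fy1 - A^-1 * (S1 + Q1))
     - mk * enorm g ^+ 2 + nk * enorm e ^+ 2
     + dotv e ((L * gam ^+ 4 / m ^+ 2) *: g + (1 - gam) *: (y1 - x)
               + gam *: (s - x)).
Proof.
move=> gam mk nk m0 A0 al0 hu hx hc hy hfy hfy1.
have Aal0 : 0 < A + al by rewrite addr_gt0.
have [Ane Aalne mne] : [/\ A != 0, A + al != 0 & m != 0] by rewrite !gt_eqF.
have gam0 : 0 < gam by rewrite divr_gt0.
pose b : R := 1 - gam.
have bE : A / (A + al) = b by rewrite /b /gam; field.
have b0 : 0 < b by rewrite -bE divr_gt0.
have bne : b != 0 by rewrite gt_eqF.
move: hu hx; rewrite bE.
move=> hu hx.
(* [y1 - x] and [c1 - x] are multiples of [p]. *)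
pose p : 'rV[R]_d := u - x.
have c1E : c1 - x = b^-1 *: p.
  rewrite /p hu /b; apply/rowP => i; rewrite !mxE /b; field.
  exact: bne.
have y1E : y1 - x = (- gam / b) *: p.
  apply: (scalerI bne); rewrite scalerA mulrCA divff// mulr1 scaleNr /p.
  have -> : b *: (y1 - x) = x - gam *: u - b *: x by rewrite {2}hx addrK scalerBr.
  by rewrite /b; apply/rowP => i; rewrite !mxE; ring.
have yE : y - x = - ((gam ^+ 2 / m) *: (g + e)).
  by rewrite hy [x - _]addrC addrK.
have cE : c - x = p - (gam / m) *: (g + e) by rewrite hc /p addrAC.
have cc1E : c - c1 = p - (gam / m) *: (g + e) - b^-1 *: p.
  by rewrite -cE -c1E opprB addrA subrK.
move: (s - x) hfy hfy1 => q; rewrite cc1E cE yE y1E !enorm_sq.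
have -> : (A + al)^-1 = A^-1 * b by rewrite -bE mulrA mulVf// mul1r.
move: p {c1E y1E yE cE cc1E} => p.
(* Every inner product is put in one fixed orientation, so that after generalization the claim
   involves scalars only. *)
rewrite !dotvE [dotv g p]dotvC [dotv e p]dotvC [dotv e g]dotvC.
move: (dotv p p) (dotvv_ge0 p) (dotv p g) (dotv p e) (dotv g g) (dotv g e)
  (dotv e e) (dotv e q) => pp pp0 pg pe gg ge ee eq.
rewrite -subr_ge0 => fy_le; rewrite -subr_ge0 => fy1_ge; rewrite -subr_ge0.
have rest0 : 0 <= gam * (m / 2) / b * pp.
  have [g0 m0' b0'] : [/\ 0 <= gam, 0 <= m & 0 <= b] by split; exact: ltW.
  by rewrite mulr_ge0// divr_ge0// mulr_ge0// divr_ge0.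
(* The right side minus the left side is exactly the smoothness slack, plus [1 - gam] times the
   convexity slack, plus [gam * m / (2 * b)] times the squared norm of [p]. *)
have := addr_ge0 (addr_ge0 fy_le (mulr_ge0 (ltW b0) fy1_ge)) rest0.
congr (0 <= _).
rewrite /mk /nk /b /gam; field.
by rewrite mne Aalne addrK Ane.
Qed.

End Euclidean.

(** * Measurability with respect to a sub-sigma-algebra *)

Section Measurability.

(* An open set of ['rV_d] is a countable union of rational boxes. *)
Lemma measurable_continuous_comp (R : realType) (d : nat) (dT : measure_display)
    (T : measurableType dT) (h : 'rV[R]_d -> R) (X : T -> 'rV[R]_d) :
  (forall i, measurable_fun setT (fun w => X w ord0 i)) -> continuous h ->
  measurable_fun setT (fun w => h (X w)).
Proof.
move=> mX ch.
pose box (qn : 'rV[rat]_d * nat) : set 'rV[R]_d :=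
  [set v | forall i, `|ratr (qn.1 ord0 i) - v ord0 i| < qn.2.+1%:R^-1].
have mbox qn : measurable (X @^-1` box qn).
  have -> : X @^-1` box qn = \bigcap_(i in [set: 'I_d])
      [set w | `|ratr (qn.1 ord0 i) - X w ord0 i| < qn.2.+1%:R^-1].
    by apply/seteqP; split => w /= H i; [move=> _|]; exact: H.
  apply: fin_bigcap_measurable => // i _.
  have mi : measurable_fun setT (fun w => `|ratr (qn.1 ord0 i) - X w ord0 i| : R).
    apply: measurableT_comp => //; apply: measurable_funB => //.
  rewrite -[X in measurable X]setTI.
  have -> : [set w | `|ratr (qn.1 ord0 i) - X w ord0 i| < qn.2.+1%:R^-1]
      = (fun w => `|ratr (qn.1 ord0 i) - X w ord0 i|) @^-1`
          `]-oo, qn.2.+1%:R^-1[.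
    by apply/seteqP; split => w /=; rewrite in_itv.
  by apply: mi => //; exact: measurable_itv.
apply: (measurability _ (RGenOInfty.measurableE R)) => _ [_ [r ->] <-].
rewrite setTI.
pose O := h @^-1` `]r, +oo[.
have -> : (fun w => h (X w)) @^-1` `]r, +oo[
    = \bigcup_(qn in [set qn | box qn `<=` O]) (X @^-1` box qn).
  apply/seteqP; split => w /=; last by move=> [qn /= qnO Xw]; exact: qnO.
  move=> Xw.
  have oO : open O.
    by apply: open_comp => [v _|]; [exact: ch|exact: rray_open].
  have /nbhs_ballP[e /= e0 eO] : nbhs (X w) O by exact: open_nbhs_nbhs.
  (* A box of half-width [1 / (n + 1)] containing [X w] stays within [2 / (n + 1) < e] of it. *)
  pose n := Num.truncn (2 / e).
  have n0 : (0 : R) < n.+1%:R^-1 by rewrite invr_gt0.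
  have ne : 2 * n.+1%:R^-1 < e.
    rewrite ltr_pdivrMr// mulrC -ltr_pdivrMr//.
    exact: truncnS_gt.
  have q_ex i : exists q : rat, `|ratr q - X w ord0 i| < n.+1%:R^-1.
    have /rat_in_itvoo[q] : X w ord0 i - n.+1%:R^-1 < X w ord0 i + n.+1%:R^-1.
      by rewrite ltrBlDr -addrA ltrDl addr_gt0.
    rewrite in_itv/= => /andP[q1 q2]; exists q.
    by rewrite ltr_distl q1 q2.
  pose q : 'rV[rat]_d := \row_i projT1 (cid (q_ex i)).
  have qE i : `|ratr (q ord0 i) - X w ord0 i| < n.+1%:R^-1.
    by rewrite mxE; case: cid.
  exists (q, n) => //= v vq; apply: eO; split => // i j.
  rewrite (ord1 i) /ball/=.
  rewrite -(subrKA (ratr (q ord0 j))) (le_lt_trans (ler_normD _ _))//.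
  rewrite (lt_trans _ ne)// mulr_natl mulr2n ltrD//.
  by rewrite distrC.
rewrite bigcup_mkcond; apply: countable_bigcupT_measurable => [|qn].
  exact: countableP.
by case: ifP => // _; exact: mbox.
Qed.
Context {dT : measure_display} {T : measurableType dT} {R : realType}.
Implicit Types (G : set (set T)) (X Y : T -> R).

(** Passing to the measurable type generated by [G] makes the closure properties of [measurable_fun]
    available for [measR]. *)
Lemma measRP G X : sigma_algebra setT G ->
  measR G X <-> measurable_fun setT (X : g_sigma_algebraType G -> R).
Proof.
move=> sG; split=> mX B.
  by move=> mB; rewrite setTI measurable_g_measurableTypeE//; exact: mX.
move=> mB; have := mX measurableT B mB.
by rewrite setTI measurable_g_measurableTypeE.
Qed.

Lemma measR_sub G X : G `<=` measurable -> measR G X -> measurable_fun setT X.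
Proof. by move=> sG mX _ B mB; rewrite setTI; exact/sG/mX. Qed.

Lemma measR_le G1 G2 X : G1 `<=` G2 -> measR G1 X -> measR G2 X.
Proof. by move=> sG mX B mB; exact/sG/mX. Qed.

Lemma measR_D G X Y : sigma_algebra setT G -> measR G X -> measR G Y ->
  measR G (fun w => X w + Y w).
Proof.
move=> sG /(measRP _ _ sG) mX /(measRP _ _ sG) mY.
by apply/(measRP _ _ sG); exact: measurable_funD.
Qed.

Lemma measR_Z G X (r : R) : sigma_algebra setT G -> measR G X ->
  measR G (fun w => r * X w).
Proof.
by move=> sG /(measRP _ _ sG) mX; apply/(measRP _ _ sG); exact: measurable_funM.
Qed.

Lemma measR_cst G (r : R) : sigma_algebra setT G -> measR G (fun=> r).
Proof. by move=> sG; apply/(measRP _ _ sG); exact: measurable_cst. Qed.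

Lemma measR_continuous_comp {d : nat} G (h : 'rV[R]_d -> R) (X : T -> 'rV[R]_d) :
  sigma_algebra setT G -> measV G X -> continuous h ->
  measR G (fun w => h (X w)).
Proof.
move=> sG mX ch; apply/(measRP _ _ sG).
apply: (@measurable_continuous_comp _ _ _ (g_sigma_algebraType G)) => // i.
by apply/(measRP _ _ sG); exact: mX.
Qed.

Lemma measV_le {d : nat} G1 G2 (U : T -> 'rV[R]_d) :
  G1 `<=` G2 -> measV G1 U -> measV G2 U.
Proof. by move=> sG mU i; exact: measR_le (mU i). Qed.

Lemma measV_D {d : nat} G (U V : T -> 'rV[R]_d) : sigma_algebra setT G ->
  measV G U -> measV G V -> measV G (fun w => U w + V w).
Proof. by move=> sG mU mV i; under eq_fun do rewrite mxE; exact: measR_D. Qed.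

Lemma measV_Z {d : nat} G (r : R) (U : T -> 'rV[R]_d) : sigma_algebra setT G ->
  measV G U -> measV G (fun w => r *: U w).
Proof. by move=> sG mU i; under eq_fun do rewrite mxE; exact: measR_Z. Qed.

Lemma measV_B {d : nat} G (U V : T -> 'rV[R]_d) : sigma_algebra setT G ->
  measV G U -> measV G V -> measV G (fun w => U w - V w).
Proof.
move=> sG mU mV; under eq_fun do rewrite -scaleN1r.
by apply: measV_D => //; exact: measV_Z.
Qed.

Lemma measV_cst {d : nat} G (c : 'rV[R]_d) : sigma_algebra setT G ->
  measV G (fun=> c).
Proof. by move=> sG i; exact: measR_cst. Qed.

(** The sets whose preimage under [w |-> (w, X w)] lies in [G] form a sigma-algebra. It contains
    both kinds of generators of the product, hence all sets provided by joint measurability. *)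
Lemma field_meas_comp {d : nat} G (e : T -> 'rV[R]_d -> 'rV[R]_d)
    (X : T -> 'rV[R]_d) :
  sigma_algebra setT G -> field_meas G e -> measV G X ->
  measV G (fun w => e w (X w)).
Proof.
move=> sG me mX i B mB.
pose pull : set (set (T * 'rV[R]_d)) := [set S | G ((fun w => (w, X w)) @^-1` S)].
suff : smallest (sigma_algebra setT) (prod_gen G) `<=` pull.
  by move=> /(_ _ (me i B mB)).
apply: smallest_sub; first split.
- by rewrite /pull/= preimage_set0; case: sG.
- move=> S GS; rewrite /pull/= setTD -[X in G X]setTD.
  by case: sG => _ GC _; exact: GC.
- by move=> F GF; rewrite /pull/= preimage_bigcup; case: sG => _ _; exact.
- move=> S [[A [GA ->]]|[j [C [mC ->]]]]; rewrite /pull/=.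
    by congr (G _) : GA; apply/seteqP; split => w /=; [|case].
  exact: mX.
Qed.

End Measurability.

(** * Orthogonality of [X] to [G]-measurable functions *)

Section Orthogonality.
Import HBNNSimple.
Context {dT : measure_display} {T : measurableType dT} {R : realType}.
Variables (P : probability T R) (G : set (set T)) (X : T -> R).
Hypotheses (sG : sub_sigma G)
  (iX : P.-integrable setT (EFin \o X))
  (X0 : forall A, G A -> (\int[P]_(w in A) (X w)%:E = 0)%E).

Lemma integral_mul_indic_eq0 (A : set T) : G A ->
  P.-integrable setT (fun w => (X w * \1_A w)%:E) /\
  (\int[P]_w (X w * \1_A w)%:E = 0)%E.
Proof.
have [_ Gm] := sG => GA.
have -> : (fun w => (X w * \1_A w)%:E) = (EFin \o X) \_ A.
  by rewrite epatch_indic; apply/funext => w /=; rewrite EFinM.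
split; last by rewrite -integral_mkcond X0.
have mA : measurable A by exact: Gm.
by apply/(integrable_mkcond _ mA); exact: integrableS iX.
Qed.

(** A [G]-simple function is a finite combination of indicators of its level sets, which lie in [G],
    so the integral vanishes term by term. *)
Lemma integral_mul_simple_eq0 (g : {nnsfun (g_sigma_algebraType G) >-> R}) :
  (\int[P]_w (X w * g w)%:E = 0)%E.
Proof.
have [saG Gm] := sG.
pose s : seq R := finmap.enum_fset (fset_set (range g)).
have GA y : G (g @^-1` [set y]).
  rewrite -[X in X _](measurable_g_measurableTypeE saG).
  exact: measurable_funPTI.
under eq_integral => w _.
  rewrite (fimfunEord g w) mulr_sumr -sumEFin.
  under eq_bigr => i _ do rewrite mulrCA EFinM.
  over.
rewrite integral_sum//= => [|i].
  rewrite big1// => i _.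
  have [iXA XA0] := integral_mul_indic_eq0 _ (GA s`_i).
  by rewrite integralZl// XA0 mule0.
by apply: integrableZl => //; have [] := integral_mul_indic_eq0 _ (GA s`_i).
Qed.

(** Dominated convergence along simple functions below [W], with dominating function the absolute
    value of [X * W]; integrability of [W] itself is not assumed. *)
Lemma integral_mul_ge0_eq0 (W : T -> R) : measR G W -> (forall w, 0 <= W w) ->
  P.-integrable setT (fun w => (X w * W w)%:E) ->
  (\int[P]_w (X w * W w)%:E = 0)%E.
Proof.
move=> mW W0 iXW; have [saG Gm] := sG.
(* Measurability is taken on the type generated by [G], so that the approximating functions are
   simple for [G] and not merely for the ambient sigma-algebra. *)
have mW' : measurable_fun [set: g_sigma_algebraType G] (EFin \o W).
  by apply/measurable_EFinP/measRP.
pose g := nnsfun_approx measurableT mW'.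
have gW w : EFin (g n w) @[n --> \oo] --> (W w)%:E.
  by apply: cvg_nnsfun_approx => // {}w _; rewrite lee_fin.
have g_le n w : g n w <= W w.
  rewrite /g nnsfun_approxE -lee_fin; apply: le_approx => // v _.
  by rewrite lee_fin.
have le_XgXW w n : (`|(X w * g n w)%:E| <= `|(X w * W w)%:E|)%E.
  rewrite lee_fin !normrM ler_wpM2l// ger0_norm ?ger0_norm//.
have mg n : measurable_fun setT (g n : T -> R).
  by apply: (measR_sub _ _ Gm); exact/(measRP _ _ saG).
have mX : measurable_fun setT X by apply/measurable_EFinP; case/integrableP: iX.
have mXg n : measurable_fun setT (fun w => (X w * g n w)%:E).
  by apply/measurable_EFinP; exact: measurable_funM.
have mXW := measurable_int _ iXW.
have cvXg w : (X w * g n w)%:E @[n --> \oo] --> (X w * W w)%:E.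
  under eq_fun do rewrite EFinM.
  by rewrite EFinM; apply: cvgeZl.
have [_ _] := @dominated_convergence _ T R P setT measurableT
  (fun n w => (X w * g n w)%:E) (fun w => (X w * W w)%:E)
  (fun w => `|(X w * W w)%:E|%E) mXg mXW (aeW _ (fun w _ => cvXg w))
  (integrable_abse iXW)
  (aeW _ (fun w n _ => le_XgXW w n)).
rewrite [X in X @ _ --> _](_ : _ = cst 0%E); last first.
  by apply/funext => n; exact: integral_mul_simple_eq0.
by move/cvg_lim => <- //; rewrite lim_cst.
Qed.

(** The positive and negative parts of [W] are written as half of its absolute value plus or minus
    [W], so both products with [X] are integrable by linearity. *)
Lemma integral_mul_eq0 (W : T -> R) : measR G W ->
  P.-integrable setT (fun w => (X w * W w)%:E) ->
  (\int[P]_w (X w * W w)%:E = 0)%E.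
Proof.
move=> mW iXW; have [saG Gm] := sG.
pose Wp w := 2^-1 * (`|W w| + W w); pose Wn w := 2^-1 * (`|W w| - W w).
have mabs : measR G (fun w => `|W w|).
  by apply/(measRP _ _ saG); apply: measurableT_comp => //; exact/measRP.
have mp : measR G Wp by apply: measR_Z => //; exact: measR_D.
have mn : measR G Wn.
  apply: measR_Z => //; apply: measR_D => //.
  by under eq_fun do rewrite -mulN1r; exact: measR_Z.
have mX : measurable_fun setT X by apply/measurable_EFinP; case/integrableP: iX.
have iabs : P.-integrable setT (fun w => (X w * `|W w|)%:E).
  apply: le_integrable iXW => //.
    by apply/measurable_EFinP; apply: measurable_funM => //; exact: measR_sub mabs.
  by move=> w _; rewrite lee_fin !normrM normr_id.
have ip : P.-integrable setT (fun w => (X w * Wp w)%:E).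
  apply: (eq_integrable _ (fun w =>
    (2^-1)%:E * ((X w * `|W w|)%:E + (X w * W w)%:E)%E)%E) => //.
    by move=> w _ /=; rewrite -EFinD -EFinM /Wp -mulrDr mulrCA.
  exact: (integrableZl measurableT (2^-1) (integrableD measurableT iabs iXW)).
have iN : P.-integrable setT (fun w => (X w * Wn w)%:E).
  apply: (eq_integrable _ (fun w =>
    (2^-1)%:E * ((X w * `|W w|)%:E - (X w * W w)%:E)%E)%E) => //.
    by move=> w _ /=; rewrite -EFinB -EFinM /Wn -mulrBr mulrCA.
  exact: (integrableZl measurableT (2^-1) (integrableB measurableT iabs iXW)).
have -> : (\int[P]_w (X w * W w)%:E
    = \int[P]_w ((X w * Wp w)%:E - (X w * Wn w)%:E))%E.
  by apply: eq_integral => w _; rewrite -EFinB /Wp /Wn; congr (_%:E); field.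
rewrite integralB// !integral_mul_ge0_eq0 ?sube0// => w.
  by rewrite mulr_ge0// subr_ge0 ler_norm.
by rewrite mulr_ge0// -lerBlDr sub0r -normrN ler_norm.
Qed.
End Orthogonality.

(** * Integrable functions and square-integrable random vectors *)

Section SquareIntegrable.
Context {dT : measure_display} {T : measurableType dT} {R : realType}.
Variable P : probability T R.
Implicit Types X Y : T -> R.

Lemma Lfun2P X : X \in Lfun P 2%:E <->
  measurable_fun setT X /\ P.-integrable setT (fun w => (X w ^+ 2)%:E).
Proof.
split=> [X2|[mX /integrableP[_ iX]]].
  split; last exact: Lfun2_integrable_sqr.
  by move: X2; rewrite inE => /andP[/[!inE]].
rewrite inE; apply/andP; split; rewrite inE//= /finite_norm unlock/=.
rewrite poweR_lty//; apply: le_lt_trans iX.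
under eq_integral => w _ do rewrite powR_mulrn// -normrX.
by [].
Qed.

Lemma LfunD p X Y : (1 <= p)%E -> X \in Lfun P p -> Y \in Lfun P p ->
  (fun w => X w + Y w) \in Lfun P p.
Proof. by move=> p1 hX hY; exact: (rpredD hX hY). Qed.

Lemma LfunB p X Y : (1 <= p)%E -> X \in Lfun P p -> Y \in Lfun P p ->
  (fun w => X w - Y w) \in Lfun P p.
Proof. by move=> p1 hX hY; exact: (rpredB hX hY). Qed.

Lemma LfunZ p (r : R) X : (1 <= p)%E -> X \in Lfun P p ->
  (fun w => r * X w) \in Lfun P p.
Proof. by move=> p1 hX; exact: (rpredZ r hX). Qed.

Lemma Lfun_sum p (I : eqType) (s : seq I) (X : I -> T -> R) : (1 <= p)%E ->
  (forall i, i \in s -> X i \in Lfun P p) ->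
  (fun w => \sum_(i <- s) X i w) \in Lfun P p.
Proof.
move=> p1; elim: s => [|i s IH] hX.
  by under eq_fun do rewrite big_nil; exact: rpred0.
under eq_fun do rewrite big_cons.
apply: LfunD => //; first by apply: hX; rewrite mem_head.
by apply: IH => j js; apply: hX; rewrite inE js orbT.
Qed.

Lemma Lfun1_le X Y : measurable_fun setT X -> (forall w, `|X w| <= Y w) ->
  Y \in Lfun P 1 -> X \in Lfun P 1.
Proof.
move=> mX XY /Lfun1_integrable iY; apply/Lfun1_integrable.
apply: le_integrable iY => //; first exact/measurable_EFinP.
by move=> w _; rewrite lee_fin (le_trans (XY w))// ler_norm.
Qed.

Lemma ExD X Y : X \in Lfun P 1 -> Y \in Lfun P 1 ->
  Ex P (fun w => X w + Y w) = Ex P X + Ex P Y.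
Proof. by move=> /Lfun1_integrable ? /Lfun1_integrable ?; exact: RintegralD. Qed.

Lemma ExB X Y : X \in Lfun P 1 -> Y \in Lfun P 1 ->
  Ex P (fun w => X w - Y w) = Ex P X - Ex P Y.
Proof. by move=> /Lfun1_integrable ? /Lfun1_integrable ?; exact: RintegralB. Qed.

Lemma ExZ (r : R) X : X \in Lfun P 1 -> Ex P (fun w => r * X w) = r * Ex P X.
Proof. by move=> /Lfun1_integrable ?; exact: RintegralZl. Qed.

Lemma Ex_le X Y : X \in Lfun P 1 -> Y \in Lfun P 1 -> (forall w, X w <= Y w) ->
  Ex P X <= Ex P Y.
Proof.
by move=> /Lfun1_integrable ? /Lfun1_integrable ? XY; exact: le_Rintegral.
Qed.

Lemma Ex_sum (I : eqType) (s : seq I) (X : I -> T -> R) :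
  (forall i, X i \in Lfun P 1) ->
  Ex P (fun w => \sum_(i <- s) X i w) = \sum_(i <- s) Ex P (X i).
Proof.
move=> hX; elim: s => [|i s IH].
  rewrite big_nil; under eq_fun do rewrite big_nil.
  by rewrite /Ex Rintegral_cst// mul0r.
rewrite big_cons -IH -ExD//; last exact: Lfun_sum.
by under eq_fun do rewrite big_cons.
Qed.

Section Vectors.
Context {d : nat}.
Implicit Types U V : T -> 'rV[R]_d.

(** Stated by coordinates, so that closure under linear operations and integrability of inner
    products reduce to the scalar case. *)
Definition Lfun2v U := forall i, (fun w => U w ord0 i) \in Lfun P 2%:E.

Lemma Lfun2v_meas U : Lfun2v U -> measV measurable U.
Proof.
move=> hU i B mB; have /Lfun2P[mU _] := hU i.
by rewrite -[X in measurable X]setTI; exact: mU.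
Qed.

Lemma Lfun2v_cst (c : 'rV[R]_d) : Lfun2v (fun=> c).
Proof. by move=> i; exact: Lfun_cst. Qed.

Lemma Lfun2vD U V : Lfun2v U -> Lfun2v V -> Lfun2v (fun w => U w + V w).
Proof.
move=> hU hV i; under eq_fun do rewrite mxE.
by apply: LfunD; rewrite ?lee1n.
Qed.

Lemma Lfun2vZ (r : R) U : Lfun2v U -> Lfun2v (fun w => r *: U w).
Proof.
move=> hU i; under eq_fun do rewrite mxE.
by apply: LfunZ; rewrite ?lee1n.
Qed.

Lemma Lfun2vB U V : Lfun2v U -> Lfun2v V -> Lfun2v (fun w => U w - V w).
Proof.
move=> hU hV; under eq_fun do rewrite -scaleN1r.
by apply: Lfun2vD => //; exact: Lfun2vZ.
Qed.

Lemma Lfun2v_sum (I : eqType) (s : seq I) (U : I -> T -> 'rV[R]_d) :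
  (forall i, i \in s -> Lfun2v (U i)) -> Lfun2v (fun w => \sum_(i <- s) U i w).
Proof.
move=> hU j; under eq_fun do rewrite summxE.
by apply: Lfun_sum => [|i si]; [rewrite lee1n|exact: hU].
Qed.

Lemma Lfun1_dotv U V : Lfun2v U -> Lfun2v V ->
  (fun w => dotv (U w) (V w)) \in Lfun P 1.
Proof. by move=> hU hV; apply: Lfun_sum => // i _; exact: Lfun2_mul_Lfun1. Qed.

Lemma Lfun1_enorm_sq U : Lfun2v U -> (fun w => enorm (U w) ^+ 2) \in Lfun P 1.
Proof. by move=> hU; under eq_fun do rewrite enorm_sq; exact: Lfun1_dotv. Qed.

Lemma Lfun2v_le U (Y : T -> R) :
  (forall i, measurable_fun setT (fun w => U w ord0 i)) ->
  (forall w, enorm (U w) ^+ 2 <= Y w) -> Y \in Lfun P 1 -> Lfun2v U.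
Proof.
move=> mU UY hY i; apply/Lfun2P; split => //; apply/Lfun1_integrable.
apply: Lfun1_le hY => [|w]; first exact: measurable_funX.
by rewrite ger0_norm ?sqr_ge0// (le_trans _ (UY w))// enorm_sq sqr_coord_le_dotvv.
Qed.

(** Scalar orthogonality is applied in each coordinate; square integrability of both vectors makes
    the products integrable. *)
Lemma Ex_dotv_eq0 (G : set (set T)) U V : sub_sigma G -> cond_mean_zero P G U ->
  measV G V -> Lfun2v U -> Lfun2v V -> Ex P (fun w => dotv (U w) (V w)) = 0.
Proof.
move=> sG [iU U0] mV hU hV; rewrite Ex_sum => [|i]; last exact: Lfun2_mul_Lfun1.
rewrite big1// => i _; rewrite /Ex /Rintegral.
rewrite (integral_mul_eq0 P G _ sG (iU i))// => [A GA|].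
  exact: U0.
by apply/Lfun1_integrable; exact: Lfun2_mul_Lfun1.
Qed.

End Vectors.
End SquareIntegrable.

(** * Bounds on a smooth function around its minimizer *)

Section SmoothFunction.
Context {R : realType} {d : nat}.
Variables (f : 'rV[R]_d -> R) (m L : R) (xs : 'rV[R]_d).
Hypotheses (m0 : 0 < m) (mL : m <= L) (fS : strongly_convex_smooth m L f)
  (fmin : forall v, f xs <= f v).

(** A gradient step of length [1 / L] lowers [f] by at least the squared gradient norm over [2 * L],
    and it cannot go below [f xs]. *)
Lemma grad_sq_le (x : 'rV[R]_d) :
  enorm (grad f x) ^+ 2 <= 2 * L * (f x - f xs).
Proof.
have L0 : 0 < L by exact: lt_le_trans mL.
have [_] := fS x (x - L^-1 *: grad f x).
rewrite [_ - _ - x]addrAC subrr add0r !enorm_sq !dotvE.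
rewrite opprK; have -> : L / 2 * (L^-1 * (L^-1 * dotv (grad f x) (grad f x)))
    = (L^-1 / 2) * dotv (grad f x) (grad f x) by field; rewrite gt_eqF.
have := fmin (x - L^-1 *: grad f x).
move: (f (x - _)) (dotv _ _) => fy g2 h1 h2.
have -> : g2 = 2 * L * (L^-1 / 2 * g2) by field; rewrite gt_eqF.
rewrite ler_wpM2l ?mulr_ge0 ?(ltW L0)//; lra.
Qed.

(** Stationarity at the minimizer is [grad_sq_le] taken at [xs], where the right side is zero. *)
Lemma grad_min_dotv (v : 'rV[R]_d) : dotv (grad f xs) v = 0.
Proof.
have := grad_sq_le xs; rewrite subrr mulr0 enorm_sq => g0.
rewrite /dotv big1// => i _.
have /eqP : grad f xs ord0 i ^+ 2 = 0.
  by apply/eqP; rewrite eq_le sqr_ge0 (le_trans (sqr_coord_le_dotvv _ i)).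
by rewrite sqrf_eq0 => /eqP ->; rewrite mul0r.
Qed.

Lemma smooth_gap_le (x : 'rV[R]_d) : f x - f xs <= L / 2 * enorm (x - xs) ^+ 2.
Proof. by have [_] := fS xs x; rewrite grad_min_dotv addr0 lerBlDl. Qed.

End SmoothFunction.

(** * Integrability of [f] and its gradient along random points *)

Section SmoothFunctionIntegrability.
Context {R : realType} {d : nat} {dT : measure_display} {T : measurableType dT}.
Variables (P : probability T R) (f : 'rV[R]_d -> R) (m L : R) (xs : 'rV[R]_d).
Hypotheses (m0 : 0 < m) (mL : m <= L) (fS : strongly_convex_smooth m L f)
  (fmin : forall v, f xs <= f v) (f2 : twice_differentiable f).

Let L0 : 0 < L. Proof. exact: lt_le_trans mL. Qed.

Lemma continuous_objective : continuous f.
Proof. by move=> x; apply: differentiable_continuous; exact: f2.1. Qed.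

(** Differentiability of the gradient gives its continuity, from which the measurability of [grad f]
    at a random point follows. *)
Lemma continuous_grad_coord i : continuous (fun x => grad f x ord0 i).
Proof.
move=> x; apply: (@continuous_comp _ _ _ (grad f) (fun M : 'rV[R]_d => M ord0 i)).
  by apply: differentiable_continuous; exact: f2.2.
exact: coord_continuous.
Qed.

(** The excess [f (U w) - f xs] lies between zero and a quadratic in [U w - xs]. *)
Lemma Lfun1_objective (U : T -> 'rV[R]_d) : Lfun2v P U ->
  (fun w => f (U w)) \in Lfun P 1.
Proof.
move=> hU; have mU := Lfun2v_meas P U hU.
have mf : measurable_fun setT (fun w => f (U w)).
  apply: (measR_sub measurable) => //; apply: measR_continuous_comp => //.
    exact: sigma_algebra_measurable.
  exact: continuous_objective.
have -> : (fun w => f (U w)) = (fun w => (f (U w) - f xs) + f xs).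
  by apply/funext => w; rewrite subrK.
apply: LfunD => //; last exact: Lfun_cst.
apply: (Lfun1_le _ _ (fun w => L / 2 * enorm (U w - xs) ^+ 2)).
- exact: measurable_funB.
- move=> w; rewrite ger0_norm ?subr_ge0//.
  exact: (smooth_gap_le _ m).
- apply: LfunZ => //; apply: Lfun1_enorm_sq; apply: Lfun2vB => //.
  exact: Lfun2v_cst.
Qed.

Lemma measV_grad (G : set (set T)) (U : T -> 'rV[R]_d) : sigma_algebra setT G ->
  measV G U -> measV G (fun w => grad f (U w)).
Proof.
move=> sG mU i; apply: (measR_continuous_comp G (fun x => grad f x ord0 i)) => //.
exact: continuous_grad_coord.
Qed.

Lemma Lfun2v_grad (U : T -> 'rV[R]_d) : Lfun2v P U ->
  Lfun2v P (fun w => grad f (U w)).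
Proof.
move=> hU; apply: (Lfun2v_le _ _ (fun w => 2 * L * (f (U w) - f xs))).
- move=> i; apply: (measR_sub measurable) => //; apply: measV_grad.
    exact: sigma_algebra_measurable.
  exact: Lfun2v_meas.
- by move=> w; exact: (grad_sq_le _ m).
- apply: LfunZ => //; apply: LfunB => //; last exact: Lfun_cst.
  exact: Lfun1_objective.
Qed.

End SmoothFunctionIntegrability.

(** * Pathwise analysis of the iterates *)

Section Iterates.
Context {R : realType} {d : nat} {T : Type}.
Variables (f : 'rV[R]_d -> R) (m L : R) (a : nat -> R)
  (eps : nat -> T -> 'rV[R]_d -> 'rV[R]_d) (x y z : nat -> T -> 'rV[R]_d).
Hypotheses (m0 : 0 < m) (a0 : forall k, (1 <= k)%N -> 0 < a k)
  (it : iada_iterates f m a eps x y z).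

Local Notation om := (omega f eps x).
Local Notation c k w := (grad_phistar a m x k w (z k w)).

Lemma AcoefS k : Acoef a k.+1 = Acoef a k + a k.+1.
Proof. by rewrite /Acoef big_nat_recr. Qed.

Lemma Acoef0 : Acoef a 0 = 0.
Proof. by rewrite /Acoef big_geq. Qed.

Lemma Acoef_gt0 k : (1 <= k)%N -> 0 < Acoef a k.
Proof.
elim: k => // -[|k] IH _; rewrite AcoefS; first by rewrite Acoef0 add0r a0.
by rewrite addr_gt0 ?IH ?a0.
Qed.

Lemma grad_phistarE k w v : (1 <= k)%N ->
  (Acoef a k * m) *: grad_phistar a m x k w v
    = v + m *: \sum_(1 <= i < k.+1) a i *: x i w.
Proof.
by move=> k1; rewrite scalerA divff ?scale1r// mulf_neq0 ?gt_eqF ?Acoef_gt0.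
Qed.

(* [A_0 = 0], so the implicit equation for [x_1] reads
   [x_1 = x_1 + z_0 / (a_1 m)]. *)
Lemma z_init w : z 0%N w = 0.
Proof.
have [x1 _ _] := it 1%N w isT.
have a1 := a0 1%N isT.
have A1 : Acoef a 1 = a 1%N by rewrite AcoefS Acoef0 add0r.
move: x1; rewrite /= Acoef0 A1 mul0r scale0r add0r divff ?gt_eqF// scale1r.
move=> x1; have := grad_phistarE 1%N w (z 0%N w) isT.
rewrite -x1 A1 big_nat1 scalerA mulrC => /eqP.
by rewrite -subr_eq subrr => /eqP <-.
Qed.

Lemma zE k w : z k w = - \sum_(1 <= i < k.+1) a i *: om i w.
Proof.
elim: k => [|k IH]; first by rewrite z_init big_geq// oppr0.
by have [_ -> _] := it k.+1 w isT; rewrite /= IH [in RHS]big_nat_recr//= opprD.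
Qed.

(** This is the stationarity condition of [quad_center]: the mirror point at [z k] minimizes the
    quadratic inside the lower bound. *)
Lemma centerE k w : (1 <= k)%N -> (Acoef a k * m) *: c k w
  = - (\sum_(1 <= i < k.+1) a i *: om i w) + m *: \sum_(1 <= i < k.+1) a i *: x i w.
Proof. by move=> k1; rewrite grad_phistarE// zE. Qed.

(** The mirror map is affine with slope [1 / (Acoef a k * m)], and the dual point moves by
    [- a k *: om k w]. *)
Lemma center_step k w : (1 <= k)%N ->
  c k w = grad_phistar a m x k w (z k.-1 w) - (a k / Acoef a k / m) *: om k w.
Proof.
move=> k1; have A0 := Acoef_gt0 _ k1.
have [_ -> _] := it k w k1.
rewrite /grad_phistar addrAC scalerDr scalerN scalerA; congr (_ - _ *: _).
by field; rewrite !gt_eqF.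
Qed.

(** The points [x k] and [y k] are the same combination, with the mirror map taken at [z k.-1] and
    at [z k]; [center_step] gives the difference, scaled once more by [a k / Acoef a k]. *)
Lemma yE k w : (1 <= k)%N ->
  y k w = x k w - ((a k / Acoef a k) ^+ 2 / m) *: om k w.
Proof.
move=> k1; have [xk zk ->] := it k w k1.
rewrite center_step// scalerBr addrA -xk scalerA; congr (_ - _ *: _).
by ring.
Qed.

Lemma LboundE xs k w : (1 <= k)%N -> Lbound f m a eps x xs k w
  = (Acoef a k)^-1 * (\sum_(1 <= i < k.+1)
        a i * (f (x i w) - dotv (eps i.+1 w (x i w)) (xs - x i w))
      + quad m a (x ^~ w) (om ^~ w) k (c k w)).
Proof.
move=> k1; rewrite /Lbound; congr (_ * (_ + _)).
apply: inf_quad; first by rewrite mulr_ge0 ?ltW ?Acoef_gt0.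
exact: centerE.
Qed.

(** The noise correction is kept as one inner product, whose second factor involves only [x k.+1],
    [y k] and [xs] and is therefore known before [eps k.+2] is drawn. *)
Lemma gap_step xs k w :
  strongly_convex_smooth m L f -> (1 <= k)%N ->
  let gam := a k.+1 / Acoef a k.+1 in
  let mk := (m / 2 - gam ^+ 2 * L / 2) * gam ^+ 2 / m ^+ 2 in
  let nk := gam ^+ 2 / m - (m / 2 - gam ^+ 2 * L / 2) * gam ^+ 2 / m ^+ 2 in
  gap f m a eps x y xs k.+1 w
  <= (1 - gam) * gap f m a eps x y xs k w
     - mk * enorm (grad f (x k.+1 w)) ^+ 2
     + nk * enorm (eps k.+2 w (x k.+1 w)) ^+ 2
     + dotv (eps k.+2 w (x k.+1 w))
         ((L * gam ^+ 4 / m ^+ 2) *: grad f (x k.+1 w)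
          + (1 - gam) *: (y k w - x k.+1 w) + gam *: (xs - x k.+1 w)).
Proof.
move=> fS k1; rewrite /= /gap !LboundE//.
have A0 := Acoef_gt0 _ k1; have ak0 := a0 k.+1 isT.
have Ak0 : 0 < Acoef a k + a k.+1 by rewrite addr_gt0.
rewrite [\sum_(1 <= i < k.+2) _]big_nat_recr//= quadS.
(* The old part of the quadratic, evaluated at the new center, is expanded about the old center, so
   that the minimum in the previous lower bound reappears. *)
rewrite (quad_center _ _ _ _ _ _ _ (centerE _ w k1)).
rewrite !AcoefS.
apply: (gap_step_vectors _ _ _ _ (f (x k.+1 w)) _ _ _ _ (x k.+1 w) (y k.+1 w) (y k w)
  _ _ (grad_phistar a m x k.+1 w (z k w))) => //.
(* With the dual point still [z k], the new mirror map averages the old center and [x k.+1] with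
   weights [Acoef a k] and [a k.+1]. *)
- have mA : (Acoef a k + a k.+1) * m != 0 by rewrite mulf_neq0 ?gt_eqF.
  apply: (scalerI mA); rewrite -AcoefS grad_phistarE// big_nat_recr//= scalerDr.
  rewrite addrA -grad_phistarE// AcoefS scalerDr !scalerA; congr (_ *: _ + _ *: _).
    by field; rewrite !gt_eqF.
  by field; rewrite gt_eqF.
- by have [] := it k.+1 w isT; rewrite AcoefS.
- by rewrite center_step// AcoefS.
- by rewrite yE// AcoefS.
- by have [] := fS (x k.+1 w) (y k.+1 w).
(* The nonnegative quadratic term of strong convexity is dropped. *)
- have [+ _] := fS (x k.+1 w) (y k w); apply: le_trans.
  by rewrite lerDl mulr_ge0 ?sqr_ge0// divr_ge0 ?ltW.
Qed.

End Iterates.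

(** * Measurability and integrability of the iterates and of the gap *)

Section IterateIntegrability.
Context {R : realType} {d : nat} {dT : measure_display} {T : measurableType dT}.
Variables (P : probability T R) (f : 'rV[R]_d -> R) (m L : R) (xs : 'rV[R]_d)
  (G : nat -> set (set T)) (eps : nat -> T -> 'rV[R]_d -> 'rV[R]_d)
  (a : nat -> R) (x y z : nat -> T -> 'rV[R]_d).
Hypotheses (m0 : 0 < m) (mL : m <= L) (f2 : twice_differentiable f)
  (fS : strongly_convex_smooth m L f) (fmin : forall v, f xs <= f v)
  (fG : filtration G) (meps : forall k, field_meas (G k.+1) (eps k.+1))
  (a0 : forall k, (1 <= k)%N -> 0 < a k)
  (mx : forall k, (1 <= k)%N -> measV (G k) (x k))
  (it : iada_iterates f m a eps x y z)
  (ix : forall k, (1 <= k)%N ->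
     P.-integrable setT (fun w => (enorm (x k w) ^+ 2)%:E) /\
     P.-integrable setT (fun w => (enorm (eps k.+1 w (x k w)) ^+ 2)%:E)).

Local Notation om := (omega f eps x).
Local Notation noise k := (fun w => eps k.+1 w (x k w)).

Let sG k : sigma_algebra setT (G k). Proof. by have [/(_ k)[]] := fG. Qed.
Let Gm k : G k `<=` measurable. Proof. by have [/(_ k)[]] := fG. Qed.
Let GS k : G k `<=` G k.+1. Proof. by have [_] := fG. Qed.

Lemma measV_noise k : (1 <= k)%N -> measV (G k.+1) (noise k).
Proof.
move=> k1; apply: field_meas_comp => //.
by apply: (measV_le (G k)) => //; exact: mx.
Qed.

Lemma Lfun2v_iterate k : (1 <= k)%N -> Lfun2v P (x k).
Proof.
move=> k1; have [ixk _] := ix k k1.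
apply: (Lfun2v_le _ _ (fun w => enorm (x k w) ^+ 2)) => //.
  by move=> i; apply: measR_sub (Gm k) _; exact: mx.
exact/Lfun1_integrable.
Qed.

Lemma Lfun2v_noise k : (1 <= k)%N -> Lfun2v P (noise k).
Proof.
move=> k1; have [_ iek] := ix k k1.
apply: (Lfun2v_le _ _ (fun w => enorm (eps k.+1 w (x k w)) ^+ 2)) => //.
  by move=> i; apply: measR_sub (Gm k.+1) _; exact: measV_noise.
exact/Lfun1_integrable.
Qed.

Lemma Lfun2v_omega k : (1 <= k)%N -> Lfun2v P (om k).
Proof.
move=> k1; apply: Lfun2vD; last exact: Lfun2v_noise.
by apply: (Lfun2v_grad P f m L xs) => //; exact: Lfun2v_iterate.
Qed.

Lemma measV_omega k : (1 <= k)%N -> measV (G k.+1) (om k).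
Proof.
move=> k1; apply: measV_D => //; last exact: measV_noise.
by apply: measV_grad => //; apply: (measV_le (G k)) => //; exact: mx.
Qed.

Let y_eq k : (1 <= k)%N ->
  y k = fun w => x k w - ((a k / Acoef a k) ^+ 2 / m) *: om k w.
Proof. by move=> k1; apply/funext => w; exact: (yE f m a eps x y z). Qed.

Lemma Lfun2v_y k : (1 <= k)%N -> Lfun2v P (y k).
Proof.
move=> k1; rewrite y_eq//; apply: Lfun2vB; first exact: Lfun2v_iterate.
by apply: Lfun2vZ; exact: Lfun2v_omega.
Qed.

(** Since [y k] contains the noise [eps k.+1], it is measurable one index later than [x k], which is
    still early enough to be paired with [eps k.+2]. *)
Lemma measV_y k : (1 <= k)%N -> measV (G k.+1) (y k).
Proof.
move=> k1; rewrite y_eq//; apply: measV_B => //.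
  by apply: (measV_le (G k)) => //; exact: mx.
by apply: measV_Z => //; exact: measV_omega.
Qed.

Lemma Lfun2v_center k :
  Lfun2v P (fun w => grad_phistar a m x k w (z k w)).
Proof.
apply: Lfun2vZ; apply: Lfun2vD.
  have -> : z k = fun w => -1 *: \sum_(1 <= i < k.+1) a i *: om i w.
    by apply/funext => w; rewrite scaleN1r; exact: (zE f m a eps x y z).
  apply: Lfun2vZ; apply: Lfun2v_sum => i.
  by rewrite mem_index_iota => /andP[i1 _]; apply: Lfun2vZ; exact: Lfun2v_omega.
apply: Lfun2vZ; apply: Lfun2v_sum => i.
by rewrite mem_index_iota => /andP[i1 _]; apply: Lfun2vZ; exact: Lfun2v_iterate.
Qed.

Lemma Lfun1_gap k : (1 <= k)%N -> gap f m a eps x y xs k \in Lfun P 1.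
Proof.
move=> k1; have hc := Lfun2v_center k; rewrite /gap.
(* Replacing the infimum by its value at the center leaves finite sums of objective values, inner
   products and squared norms. *)
under eq_fun do rewrite (LboundE f m a eps x y z)//.
apply: LfunB => //.
  by apply: (Lfun1_objective P f m L xs) => //; exact: Lfun2v_y.
apply: LfunZ => //; apply: LfunD => //; apply: Lfun_sum => // i;
  rewrite mem_index_iota => /andP[i1 _].
- have hx := Lfun2v_iterate i i1.
  apply: LfunZ => //; apply: LfunB => //.
    exact: (Lfun1_objective P f m L xs).
  apply: Lfun1_dotv; first exact: Lfun2v_noise.
  by apply: Lfun2vB => //; exact: Lfun2v_cst.
- have hcx := Lfun2vB P _ _ hc (Lfun2v_iterate i i1).
  apply: LfunZ => //; apply: LfunD => //.
    by apply: Lfun1_dotv => //; exact: Lfun2v_omega.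
  by apply: LfunZ => //; exact: Lfun1_enorm_sq.
Qed.

End IterateIntegrability.

(** * Expectation of the one-step inequality *)

Theorem theorem2
  (R : realType) (d : nat) (f : 'rV[R]_d -> R) (m L : R) (xstar : 'rV[R]_d)
  (dT : measure_display) (T : measurableType dT) (P : probability T R)
  (G : nat -> set (set T)) (eps : nat -> T -> 'rV[R]_d -> 'rV[R]_d)
  (a : nat -> R) (x y z : nat -> T -> 'rV[R]_d) :
  0 < m -> m <= L ->
  twice_differentiable f ->
  strongly_convex_smooth m L f ->
  (forall v, f xstar <= f v) ->
  filtration G ->
  (forall k, field_meas (G k.+1) (eps k.+1)) ->
  (forall k (zeta : T -> 'rV[R]_d), measV (G k) zeta ->
     (forall i : 'I_d,
        P.-integrable setT (fun w => (eps k.+1 w (zeta w) ord0 i)%:E)) ->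
     cond_mean_zero P (G k) (fun w => eps k.+1 w (zeta w))) ->
  fields_independent P eps ->
  fields_identically_distributed P eps ->
  (forall k, (1 <= k)%N -> 0 < a k) ->
  (forall k, (1 <= k)%N -> measV (G k) (x k)) ->
  iada_iterates f m a eps x y z ->
  (forall k, (1 <= k)%N ->
     P.-integrable setT (fun w => (enorm (x k w) ^+ 2)%:E) /\
     P.-integrable setT (fun w => (enorm (eps k.+1 w (x k w)) ^+ 2)%:E)) ->
  forall k, (2 <= k)%N ->
    let gam := a k / Acoef a k in
    let mk := (m / 2 - gam ^+ 2 * L / 2) * gam ^+ 2 / m ^+ 2 in
    let nk := gam ^+ 2 / m - (m / 2 - gam ^+ 2 * L / 2) * gam ^+ 2 / m ^+ 2 in
    Ex P (gap f m a eps x y xstar k)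
    <= (1 - gam) * Ex P (gap f m a eps x y xstar k.-1)
       - mk * Ex P (fun w => enorm (grad f (x k w)) ^+ 2)
       + nk * Ex P (fun w => enorm (eps k.+1 w (x k w)) ^+ 2).
Proof.
(* The index is shifted: the current step is [k.+1] with [1 <= k], and its fresh noise is
   [eps k.+2]. *)
move=> m0 mL f2 fS fmin fG meps eps0 _ _ a0 mx it ix [//|k] k1; cbv zeta.
set gam := a k.+1 / Acoef a k.+1.
set mk := (m / 2 - gam ^+ 2 * L / 2) * gam ^+ 2 / m ^+ 2.
set nk := gam ^+ 2 / m - mk.
have sG j : sub_sigma (G j) by exact: fG.1.
have saG j : sigma_algebra setT (G j) by exact: (sG j).1.
have GS : G k `<=` G k.+1 by exact: fG.2.
set X := x k.+1; pose E w := eps k.+2 w (X w).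
(* [V] is the vector paired with the fresh noise in [gap_step]. *)
pose V w := (L * gam ^+ 4 / m ^+ 2) *: grad f (X w)
  + (1 - gam) *: (y k w - X w) + gam *: (xstar - X w).
have X2 : Lfun2v P X by exact: (Lfun2v_iterate P G eps x).
have E2 : Lfun2v P E by exact: (Lfun2v_noise P G eps x).
have g2 : Lfun2v P (fun w => grad f (X w)) by exact: (Lfun2v_grad P f m L xstar).
have y2 : Lfun2v P (y k) by exact: (Lfun2v_y P f m L xstar G eps a x y z).
have V2 : Lfun2v P V.
  apply: Lfun2vD; last by apply/Lfun2vZ/Lfun2vB => //; exact: Lfun2v_cst.
  by apply: Lfun2vD; apply: Lfun2vZ => //; exact: Lfun2vB.
have mX : measV (G k.+1) X by exact: mx.
have mV : measV (G k.+1) V.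
  have my : measV (G k.+1) (y k).
    exact: (measV_y f m G eps a x y z).
  apply: measV_D => //; last first.
    by apply: measV_Z => //; apply: measV_B => //; exact: measV_cst.
  by apply: measV_D => //; apply: measV_Z => //; [exact: measV_grad|exact: measV_B].
(* The martingale hypothesis is used at the random point [X]; its integrability premise holds
   because square-integrable functions are integrable under a probability. *)
have EV0 : Ex P (fun w => dotv (E w) (V w)) = 0.
  apply: (Ex_dotv_eq0 P (G k.+1)) => //; apply: eps0 => // i.
  apply/Lfun1_integrable; apply: Lfun_subset12 (E2 i) => //.
  exact: fin_num_measure.
have gap1 j : (1 <= j)%N -> gap f m a eps x y xstar j \in Lfun P 1.
  by move=> j1; exact: (Lfun1_gap P f m L xstar G eps a x y z).
have hg := LfunZ P 1 mk _ (lexx _) (Lfun1_enorm_sq P _ g2).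
have hE := LfunZ P 1 nk _ (lexx _) (Lfun1_enorm_sq P _ E2).
have hG := LfunZ P 1 (1 - gam) _ (lexx _) (gap1 k k1).
have hEV := Lfun1_dotv P _ _ E2 V2.
have hGg := LfunB P _ _ _ (lexx _) hG hg.
have hGgE := LfunD P _ _ _ (lexx _) hGg hE.
(* The pathwise bound is integrated; linearity and [EV0] then give the claim. *)
apply: (le_trans (Ex_le P _ _ (gap1 k.+1 isT) (LfunD P _ _ _ (lexx _) hGgE hEV)
  (fun w => gap_step f m L a eps x y z m0 a0 it xstar k w fS k1))).
rewrite ExD// EV0 addr0 ExD// ExB// !ExZ//; try exact: Lfun1_enorm_sq.
exact: gap1.
Qed.
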